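(* Let $H$ be a complex Hilbert space, let $A:\mathcal{D}(A)\subset H\to H$ be closed and densely defined with $0\in\varrho(A)$, let $B,D\in\mathcal{L}(H)$ with $0\in\varrho(D)$, and suppose there are constants $\gamma_A,\gamma_D>0$ with $$\operatorname{Re}\langle Ax,x\rangle\ge\gamma_A\|x\|^2\ (x\in\mathcal{D}(A)),\qquad \operatorname{Re}\langle Dx,x\rangle\le-\gamma_D\|x\|^2\ (x\in H).$$ Let $\mathcal{A}=\begin{pmatrix} A & B \\ B^* & D \end{pmatrix}$ on $H\times H$ with domain $\mathcal{D}(A)\times H$. Let $(P_n,A_n)_{n\in\mathbb{N}}$ be a family which approximates $A$ strongly, where all projections $P_n$ are orthogonal and all $A_n$ satisfy $\operatorname{Re}\langle A_nx,x\rangle\ge\gamma_A\|x\|^2$ for $x\in U_n$, with $U_n$ the range of $P_n$. Let $B_n=P_nB|_{U_n}$, $D_n=P_nD|_{U_n}$ and $\mathcal{A}_n=\begin{pmatrix} A_n & B_n \\ B_n^* & D_n \end{pmatrix}$ on $U_n\times U_n$. Let $s_1,\dots,s_m\in\{\lambda\in\mathbb{C}: -\gamma_D<\operatorname{Re}\lambda<\gamma_A\}$, let $$0<\varepsilon<\min_{j=1,\dots,m}\left(\min\{\gamma_A-\operatorname{Re}s_j,\gamma_D+\operatorname{Re}s_j\}\right)$$ and $$\delta_j>\frac{\varepsilon}{\min\{\gamma_A-\operatorname{Re}s_j,\gamma_D+\operatorname{Re}s_j\}^2-\varepsilon\min\{\gamma_A-\operatorname{Re}s_j,\gamma_D+\operatorname{Re}s_j\}}$$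 for $j=1,\dots,m$. Then there exists $n_0\in\mathbb{N}$ such that $$\sigma_\varepsilon(\mathcal{A})\subset\bigcap_{j=1}^m\left[\left(B_{\delta_j}(W((\mathcal{A}_n-s_j)^{-1}))\right)^{-1}+s_j\right]\quad\text{for all } n\ge n_0.$$
   Context: $\mathcal{L}(X)$ denotes the bounded linear operators on $X$; $\varrho$ and $\sigma$ denote resolvent set and spectrum; $H\times H$ carries the product Hilbert space structure. The family $(P_n,A_n)_{n\in\mathbb{N}}$ approximates $A$ strongly if: (i) $U_n\subset H$, $n\in\mathbb{N}$, are finite-dimensional subspaces; (ii) $P_n\in\mathcal{L}(H)$ are projections with range $U_n$ and $\lim_{n\to\infty}P_nx=x$ for all $x\in H$; (iii) $A_n\in\mathcal{L}(U_n)$ are invertible and $\lim_{n\to\infty}A_n^{-1}P_nx=A^{-1}x$ for all $x\in H$. The $\varepsilon$-pseudospectrum of an operator $T$ is $\sigma_\varepsilon(T)=\sigma(T)\cup\{\lambda\in\varrho(T): \|(T-\lambda)^{-1}\|>\frac1\varepsilon\}$. The numerical range is $W(T)=\{\langle Tx,x\rangle: x\in\mathcal{D}(T),\ \|x\|=1\}$. For $U\subset\mathbb{C}$ and $\delta>0$: $B_\delta(U)=\{z\in\mathbb{C}:\operatorname{dist}(z,U)<\delta\}$, $U^{-1}=\{z^{-1}: z\in U\setminus\{0\}\}$, $U+s=\{z+s: z\in U\}$. *)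

(* Defs.v *)
From HB Require Import structures.
From mathcomp Require Export all_boot all_order all_algebra.
From mathcomp Require Export complex.
From mathcomp Require Export all_classical all_reals all_analysis.

Set Implicit Arguments.
Unset Strict Implicit.
Unset Printing Implicit Defensive.
Import Order.TTheory GRing.Theory Num.Theory Num.Def.
Import numFieldNormedType.Exports.

Local Open Scope classical_set_scope.
Local Open Scope ring_scope.

Section ProductDot.
Context {R : realType} {V : lmodType R[i]}.

(* The inner product of the Hilbert space direct sum of V with itself. The
   library norm on V * V is the maximum norm, hence all norms on V * V below
   are derived from this form. *)
Definition prod_dot (ip : {dot V for conjC}) (z w : V * V) : R[i] :=
  ip z.1 w.1 + ip z.2 w.2.

Variable ip : {dot V for conjC}.

Lemma prod_dot_bilinear :
  bilinear_for (GRing.Scale.Law.clone _ _ *%R _)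
    (GRing.Scale.Law.clone _ _ (conjC \; *%R) _) (prod_dot ip).
Proof.
split=> u a x y; rewrite /prod_dot /=.
- by rewrite !linearDl !linearZl_LR /= mulrDr addrACA.
- by rewrite !linearDr !linearZr_LR /= addrACA.
Qed.

HB.instance Definition _ := bilinear_isBilinear.Build _ _ _ _ _ _
  (prod_dot ip) prod_dot_bilinear.

Lemma prod_dot_hermitian z w :
  prod_dot ip z w = (-1) ^+ false * conjC (prod_dot ip w z).
Proof.
rewrite /prod_dot expr0 mul1r rmorphD /=.
by congr (_ + _); rewrite hermC expr0 mul1r.
Qed.

HB.instance Definition _ := isHermitianSesquilinear.Build _ _ _ _
  (prod_dot ip) prod_dot_hermitian.

Lemma prod_dot_gt0 (z : V * V) : z != 0 -> 0 < prod_dot ip z z.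
Proof.
case: z => x y; rewrite xpair_eqE negb_and /prod_dot /=.
case/orP => [x0|y0]; [apply: ltr_wpDr|apply: ltr_wpDl].
all: by rewrite ?dnorm_ge0 ?dnorm_gt0.
Qed.

HB.instance Definition _ := isDotProduct.Build _ _ (prod_dot ip) prod_dot_gt0.

End ProductDot.

(* A possibly unbounded operator in V; the values of the underlying total
   function outside dom are irrelevant. An operator on a subspace U of V is one
   whose domain is U. *)
Record operator (V : Type) := Operator { dom : set V; app :> V -> V }.

Section Operators.
Context {R : realType} {V : lmodType R[i]}.
Implicit Types (T : operator V) (U : set V) (lambda : R[i]) (eps : R).

Definition full_op (f : V -> V) : operator V := Operator setT f.

Definition restrict_op (f : V -> V) U : operator V := Operator U f.

Definition shift_op T lambda : operator V :=
  Operator (dom T) (fun x => T x - lambda *: x).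

(* T^-1, with domain the range of T; meaningful when T is injective on dom T. *)
Definition inverse_op T : operator V :=
  Operator (T @` dom T) (fun y => xget 0 [set x | dom T x /\ T x = y]).

Definition linear_operator T :=
  dom T 0 /\
  forall a x y, dom T x -> dom T y ->
    dom T (a *: x + y) /\ T (a *: x + y) = a *: T x + T y.

Definition finite_dimensional U := exists (k : nat) (e : 'I_k -> V),
  U = [set x | exists c : 'I_k -> R[i], x = \sum_(i < k) c i *: e i].

Definition block_op (A B C D : operator V) : operator (V * V) :=
  Operator
    [set z | (dom A z.1 /\ dom C z.1) /\ (dom B z.2 /\ dom D z.2)]
    (fun z => (A z.1 + B z.2, C z.1 + D z.2)).

Variable ip : {dot V for conjC}.

Definition ipnorm (x : V) : R := Num.sqrt (complex.Re (ip x x)).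

Definition bounded_operator T :=
  exists M : R, forall x, dom T x -> ipnorm (T x) <= M * ipnorm x.

(* Real-valued supremum: meaningful for bounded T. *)
Definition opnorm T : R :=
  sup [set ipnorm (T x) | x in dom T `&` [set x | ipnorm x <= 1]].

(* The Hilbert space adjoint of a bounded operator T : U -> U on the Hilbert
   space U = dom T, a closed subspace of V. *)
Definition adjoint T : operator V :=
  Operator (dom T)
    (fun y => xget 0 [set z | dom T z /\
                              forall x, dom T x -> ip (T x) y = ip x z]).

Definition resolvent_set T : set R[i] :=
  [set lambda | set_bij (dom T) setT (shift_op T lambda) /\
                bounded_operator (inverse_op (shift_op T lambda))].

Definition spectrum T : set R[i] := ~` resolvent_set T.

Definition pseudospectrum eps T : set R[i] :=
  spectrum T `|`
  [set lambda | resolvent_set T lambda /\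
                eps^-1 < opnorm (inverse_op (shift_op T lambda))].

Definition numerical_range T : set R[i] :=
  [set ip (T x) x | x in dom T `&` [set x | ipnorm x = 1]].

Definition orthogonal_projection (P : V -> V) :=
  (forall x, P (P x) = P x) /\ (forall x y, P x = 0 -> ip x (P y) = 0).

End Operators.

Section ComplexSets.
Context {R : realType}.
Implicit Types (U : set R[i]) (z s : R[i]) (delta : R).

(* Extended-real valued, so that the distance to the empty set is +oo. *)
Definition dist_set z U : \bar R :=
  ereal_inf [set (complex.Re `|z - u|)%:E | u in U].

Definition nbhd delta U : set R[i] := [set z | (dist_set z U < delta%:E)%E].

Definition inv_set U : set R[i] := [set z^-1 | z in U `\ 0].

Definition translate U s : set R[i] := [set z + s | z in U].

Definition strip_gap (gA gD : R) s : R :=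
  Num.min (gA - complex.Re s) (gD + complex.Re s).

End ComplexSets.

Section Approximation.
Context {R : realType} {H : completeNormedModType R[i]}.
Variable ip : {dot H for conjC}.

Definition closed_operator (T : operator H) :=
  closed [set z : H * H | dom T z.1 /\ z.2 = T z.1].

(* The subspace U_n is the range of P n. *)
Record approximates_strongly (A : operator H)
    (P : nat -> {linear H -> H}) (An : nat -> operator H) : Prop := {
  approx_findim : forall n, finite_dimensional (range (P n));
  approx_proj_bounded : forall n, bounded_operator ip (full_op (P n));
  approx_proj : forall n x, P n (P n x) = P n x;
  approx_proj_cvg : forall x : H, P n x @[n --> \oo] --> x;
  approx_dom : forall n, dom (An n) = range (P n);
  approx_linear : forall n, linear_operator (An n);
  approx_bounded : forall n, bounded_operator ip (An n);
  approx_invertible : forall n,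
    set_bij (range (P n)) (range (P n)) (An n);
  approx_inv_cvg : forall x : H,
    inverse_op (An n) (P n x) @[n --> \oo] --> inverse_op A x
}.

End Approximation.

(* Main.v *)
From HB Require Import structures.
Require Import Defs.
From mathcomp Require Import ring lra.

(* For [lambda] in the pseudospectrum, [mu = lambda - s] and [T = cA - s], some
   [z] in the domain of [cA] has [|T z| = 1] and
   [|<z, T z> - mu^-1| < eps / (g ^ 2 - eps g)], where [g] is the strip gap:
   otherwise [T - mu] is bounded below by [eps], and it is onto by a Lax-Milgram
   argument which pairs it with [T]. The Galerkin vectors
   [z_n = (An^-1 P_n A z.1, P_n z.2)] satisfy [z_n -> z] and
   [(cAn - s) z_n -> T z], so that [<z, T z>] is a limit of elements of
   [W((cAn - s)^-1)]; since the numbers [<z, T z>] form a bounded set, this is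
   uniform in [z]. *)

Set Implicit Arguments.
Unset Strict Implicit.
Unset Printing Implicit Defensive.
Import Order.TTheory GRing.Theory Num.Theory Num.Def.
Import numFieldNormedType.Exports.

Local Open Scope classical_set_scope.
Local Open Scope ring_scope.

(** Two obstacles shape the proof. A lower bound for [T - mu] excludes [lambda] from the
    pseudospectrum only if [T - mu] is also onto, which no lower bound provides. Surjectivity is
    therefore drawn from coercivity against a partner map that is itself onto: a perturbation of the
    pairing with [(x, - y)] for [T], then [T] for [T - mu]. The second obstacle is that strong
    approximation controls [An^-1] but says nothing about the convergence of [An]. Numerical ranges
    of inverses suit this, since [<T^-1 f, f>] with [f = T z] equals [<z, T z>]: it suffices to find
    vectors which converge together with their images, and no inverse of a block operator has to be
    estimated. The constant is [eps / (g (g - eps))]: one factor is the lower bound [g] of [T], the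
    other the bound [|mu| >= g - eps] that holds whenever [|(T - mu) z| < eps |z|] for some [z]. The
    strict inequality for [delta_j] leaves a positive margin, which pays for the Galerkin error. *)

Section Modulus.
Context {R : realType}.
Implicit Types (z w : R[i]) (r : R).

(** The library norm takes values in [R[i]]; estimates are carried out in the ordered field [R],
    where [lra] and [nra] apply. *)
Definition modulus z : R := complex.Re `|z|.

Lemma normc_modulus z : `|z| = (modulus z)%:C%C.
Proof. by rewrite /modulus normc_def. Qed.

Lemma modulus_ge0 z : 0 <= modulus z.
Proof. by rewrite -ler0c -normc_modulus. Qed.

Lemma modulusM z w : modulus (z * w) = modulus z * modulus w.
Proof. by apply: complexI; rewrite rmorphM /= -!normc_modulus normrM. Qed.

Lemma modulusD z w : modulus (z + w) <= modulus z + modulus w.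
Proof. by rewrite -lecR rmorphD /= -!normc_modulus ler_normD. Qed.

Lemma modulusN z : modulus (- z) = modulus z.
Proof. by rewrite /modulus normrN. Qed.

Lemma modulusB z w : modulus (z - w) = modulus (w - z).
Proof. by rewrite -modulusN opprB. Qed.

Lemma modulus_eq0 z : (modulus z == 0) = (z == 0).
Proof.
by rewrite -[RHS]normr_eq0 normc_modulus -(inj_eq (@complexI R)).
Qed.

Lemma modulus_gt0 z : (0 < modulus z) = (z != 0).
Proof. by rewrite lt_def modulus_ge0 andbT modulus_eq0. Qed.

Lemma modulusC r : modulus r%:C%C = `|r|.
Proof. by rewrite /modulus normc_def /= expr0n addr0 sqrtr_sqr. Qed.

Lemma modulus_conj z : modulus z^* = modulus z.
Proof. by rewrite /modulus norm_conjC. Qed.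

Lemma mul_conj_modulus z : z * z^* = (modulus z ^+ 2)%:C%C.
Proof. by rewrite -normCK normc_modulus rmorphXn. Qed.

Lemma complexReD z w : complex.Re (z + w) = complex.Re z + complex.Re w.
Proof. by case: z w => [? ?] []. Qed.

Lemma complexReN z : complex.Re (- z) = - complex.Re z.
Proof. by case: z. Qed.

Lemma complexRe_realM r z : complex.Re (r%:C%C * z) = r * complex.Re z.
Proof. by case: z => a b /=; rewrite mul0r subr0. Qed.

Lemma complexRe_conj z : complex.Re z^* = complex.Re z.
Proof. by case: z. Qed.

Lemma normr_Re_le z : `|complex.Re z| <= modulus z.
Proof. by rewrite -lecR -normc_modulus normc_ge_Re. Qed.

Lemma normr_Im_le z : `|complex.Im z| <= modulus z.
Proof.
rewrite /modulus normc_def /= -[X in X <= _]sqrtr_sqr; apply: ler_wsqrtr.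
by rewrite lerDr sqr_ge0.
Qed.

Lemma modulus_le_ReIm z : modulus z <= `|complex.Re z| + `|complex.Im z|.
Proof.
rewrite -[X in _ <= X]ger0_norm ?addr_ge0// -sqrtr_sqr /modulus normc_def /=.
apply: ler_wsqrtr; rewrite sqrrD !real_normK ?num_real//.
by rewrite -addrA lerD2l lerDr mulrn_wge0// mulr_ge0.
Qed.

Lemma Re_le_modulus z : complex.Re z <= modulus z.
Proof. exact: le_trans (ler_norm _) (normr_Re_le z). Qed.

Lemma Re_ge_modulus z : - modulus z <= complex.Re z.
Proof. by have := normr_Re_le z; rewrite ler_norml => /andP[]. Qed.

End Modulus.

(** * Inner products and the real-valued norm they induce *)

Section InnerProduct.
Context {R : realType} {V : lmodType R[i]}.
Variable ip : {dot V for conjC}.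
Local Notation N := (ipnorm ip).
Implicit Types (x y : V) (t : R[i]).

Lemma ip_conj x y : ip x y = (ip y x)^*.
Proof. by rewrite hermC expr0 mul1r. Qed.

Lemma ipnorm_ge0 x : 0 <= N x.
Proof. exact: sqrtr_ge0. Qed.

Lemma ipDl x y z : ip (x + y) z = ip x z + ip y z.
Proof. by rewrite linearDl. Qed.

Lemma ipDr x y z : ip x (y + z) = ip x y + ip x z.
Proof. by rewrite linearDr. Qed.

Lemma ipBl x y z : ip (x - y) z = ip x z - ip y z.
Proof. by rewrite linearBl. Qed.

Lemma ipNr x y : ip x (- y) = - ip x y.
Proof. by rewrite linearNr. Qed.

Lemma ipZl t x y : ip (t *: x) y = t * ip x y.
Proof. by rewrite linearZl_LR. Qed.

Lemma ipZr t x y : ip x (t *: y) = t^* * ip x y.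
Proof. by rewrite linearZr_LR. Qed.

Lemma ip_ipnorm x : ip x x = (N x ^+ 2)%:C%C.
Proof.
have ge0 := dnorm_ge0 ip x.
have e : ip x x = (complex.Re (ip x x))%:C%C by rewrite RRe_real ?ger0_real.
by rewrite /ipnorm sqr_sqrtr// -ler0c -e.
Qed.

Lemma ipnorm_eq0 x : (N x == 0) = (x == 0).
Proof.
rewrite -(dnorm_eq0 ip) ip_ipnorm -(sqrf_eq0 (N x)).
by rewrite -(inj_eq (@complexI R)).
Qed.

Lemma ipnorm0 : N 0 = 0.
Proof. by apply/eqP; rewrite ipnorm_eq0. Qed.

Lemma ipnorm_sqrDZ x y t :
  N (x + t *: y) ^+ 2 =
  N x ^+ 2 + 2 * complex.Re (t * ip y x) + modulus t ^+ 2 * N y ^+ 2.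
Proof.
apply: complexI; rewrite -ip_ipnorm dnormD dnormZ !ip_ipnorm normc_modulus.
rewrite linearZr_LR /= [X in _ + X](_ : _ = (2 * complex.Re (t * ip y x))%:C%C).
  by rewrite !rmorphD !rmorphM /= addrAC.
rewrite (ip_conj x y); case: (ip y x) => a b; case: t => c d.
by apply/eqP; rewrite eq_complex /=; apply/andP; split; apply/eqP => /=; ring.
Qed.

Lemma ipnorm_sqrD x y :
  N (x + y) ^+ 2 = N x ^+ 2 + N y ^+ 2 + 2 * complex.Re (ip x y).
Proof.
rewrite -[in LHS](scale1r y) ipnorm_sqrDZ mul1r modulusC normr1.
by rewrite ip_conj complexRe_conj; ring.
Qed.

Lemma ipnormZ t x : N (t *: x) = modulus t * N x.
Proof.
apply/eqP; rewrite -(eqrXn2 (n := 2))// ?mulr_ge0 ?modulus_ge0 ?ipnorm_ge0//.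
by rewrite -[t *: x]add0r ipnorm_sqrDZ ipnorm0 linear0r mulr0/= exprMn; apply/eqP; ring.
Qed.

Lemma ipnormN x : N (- x) = N x.
Proof. by rewrite -scaleN1r ipnormZ modulusN modulusC normr1 mul1r. Qed.

Lemma ipnormB x y : N (x - y) = N (y - x).
Proof. by rewrite -ipnormN opprB. Qed.

Lemma cauchy_schwarz x y : modulus (ip x y) <= N x * N y.
Proof.
have [->|y0] := eqVneq y 0.
  by rewrite linear0r ipnorm0 mulr0 modulusC normr0.
have Ny : 0 < N y ^+ 2 by rewrite exprn_gt0// lt_def ipnorm_eq0 y0 ipnorm_ge0.
rewrite -ler_sqr ?nnegrE ?mulr_ge0 ?modulus_ge0 ?ipnorm_ge0// exprMn.
pose e := ip y x; have -> : modulus (ip x y) = modulus e.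
  by rewrite ip_conj modulus_conj.
(* The coefficient [- tau e^*] is the minimiser of [N (x + t y)] over [t]; the minimum squared is
   [N x ^ 2 - tau |e| ^ 2]. *)
pose tau := (N y ^+ 2)^-1.
have := sqr_ge0 (N (x + (- (tau%:C%C * e^*)) *: y)).
rewrite ipnorm_sqrDZ -/e mulNr complexReN -mulrA [e^* * e]mulrC mul_conj_modulus.
rewrite -rmorphM /= modulusN modulusM modulus_conj modulusC ger0_norm; last first.
  by rewrite invr_ge0 ltW.
rewrite exprMn.
rewrite [X in 0 <= X](_ : _ = N x ^+ 2 - modulus e ^+ 2 * tau); last first.
  by rewrite /tau; field; apply/eqP => h; rewrite h expr0n ltxx in Ny.
by rewrite subr_ge0 ler_pdivrMr.
Qed.

Lemma ipnormD x y : N (x + y) <= N x + N y.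
Proof.
rewrite -ler_sqr ?nnegrE ?addr_ge0 ?ipnorm_ge0// ipnorm_sqrD.
have := le_trans (Re_le_modulus _) (cauchy_schwarz x y); nra.
Qed.

Lemma lerB_ipnorm x y : N x - N y <= N (x - y).
Proof. by rewrite lerBlDr -{1}(subrK y x) ipnormD. Qed.

Lemma parallelogram x y :
  N (x - y) ^+ 2 = 2 * N x ^+ 2 + 2 * N y ^+ 2 - N (x + y) ^+ 2.
Proof.
rewrite !ipnorm_sqrD ipnormN linearNr complexReN; ring.
Qed.

End InnerProduct.

(** * Variational problems in a complete inner product space *)

Lemma le0_of_le_mul (R : realFieldType) (x c : R) :
  (forall e, 0 < e -> x <= c * e) -> x <= 0.
Proof.
move=> h; rewrite leNgt; apply/negP => x0.
have c0 : 0 < `|c| + 1 by rewrite ltr_wpDl.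
(* For this [e] the assumption gives [x <= x / 2]; the summand [1] covers [c = 0]. *)
have e0 : 0 < x / 2 / (`|c| + 1) by rewrite !divr_gt0.
have : c * (x / 2 / (`|c| + 1)) <= (`|c| + 1) * (x / 2 / (`|c| + 1)).
  by rewrite ler_wpM2r ?(ltW e0)// (le_trans (ler_norm c))// lerDl.
rewrite mulrC [leRHS]mulrC divfK ?gt_eqF// => h1.
have := h _ e0; rewrite mulrC; lra.
Qed.

Section Hilbert.
Context {R : realType} {V : lmodType R[i]}.
Variable ip : {dot V for conjC}.
Local Notation N := (ipnorm ip).
Local Notation bounded f := (bounded_operator ip (full_op f)).

(** Phrased through [ipnorm] so that it applies to [V * V] with [prod_dot], whose norm is not the
    library norm of the product. *)
Definition ip_complete := forall u : nat -> V,
  (forall e, 0 < e -> exists n0, forall p q,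
    (n0 <= p)%N -> (n0 <= q)%N -> N (u p - u q) < e) ->
  exists l, forall e, 0 < e -> exists n0, forall n, (n0 <= n)%N -> N (u n - l) < e.

Lemma bounded_gt0 (f : V -> V) : bounded f ->
  exists2 M, 0 < M & forall x, N (f x) <= M * N x.
Proof.
case=> M hM; exists (`|M| + 1); first by rewrite ltr_wpDl.
move=> x; apply: le_trans (hM x I) _; rewrite ler_wpM2r ?ipnorm_ge0//.
by rewrite (le_trans (ler_norm M))// lerDl.
Qed.

Lemma inv_succ_small (e : R) : 0 < e ->
  exists n0 : nat, forall n, (n0 <= n)%N -> n.+1%:R^-1 < e.
Proof.
move=> e0; exists (Num.truncn e^-1) => n hn.
rewrite invf_plt ?posrE// (lt_le_trans (truncnS_gt _))// ler_nat ltnS//.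
Qed.

(* Minimises the functional [N (L x) ^ 2 - 2 Re (phi x)]: by the parallelogram
   law a minimising sequence is a Cauchy sequence, and the stated equation is
   the Euler equation at its limit. *)
Lemma least_squares (L : {linear V -> V}) (phi : {scalar V}) (c k : R) :
  ip_complete -> bounded L ->
  0 < c -> (forall x, c * N x <= N (L x)) ->
  (forall x, modulus (phi x) <= k * N x) ->
  exists x, forall y, ip (L y) (L x) = phi y.
Proof.
move=> cpl /bounded_gt0[a a0 La] c0 Lc phik.
pose F x := N (L x) ^+ 2 - 2 * complex.Re (phi x).
(* With [r = c * N x] the functional is at least [r ^ 2 - 2 (k / c) r]; completing the square bounds
   it below. *)
have Flb x : - (k / c) ^+ 2 <= F x.
  have h1 : (c * N x) ^+ 2 <= N (L x) ^+ 2.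
    by rewrite ler_sqr ?nnegrE ?Lc ?mulr_ge0 ?ipnorm_ge0// ltW.
  have h2 := le_trans (Re_le_modulus (phi x)) (phik x).
  have h3 : k * N x = (k / c) * (c * N x) by field; rewrite gt_eqF.
  rewrite h3 in h2; rewrite /F.
  have := sqr_ge0 (c * N x - k / c); nra.
pose m := inf (range F).
have hinf : has_inf (range F).
  split; first by exists (F 0), 0.
  by exists (- (k / c) ^+ 2) => _ [x _ <-].
have Fm x : m <= F x by apply: ge_inf; [case: hinf | exists x].
have /choice[u Fu] (n : nat) : exists x, F x < m + n.+1%:R^-1.
  have [|_ [x _ <-] hx] := @inf_adherent _ (range F) n.+1%:R^-1 _ hinf.
    by rewrite invr_gt0 ltr0n.
  by exists x.
(* The infimum is compared with the value of [F] at the midpoint of [p] and [q]. *)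
have mid p q : N (L (p - q)) ^+ 2 <= 2 * (F p + F q - 2 * m).
  have := Fm (2^-1%:C%C *: (p + q)).
  rewrite /F (linearZ_LR L) (linearZ_LR phi) /= ipnormZ modulusC complexRe_realM.
  rewrite (linearD L) (linearD phi) (linearB L) /= complexReD.
  rewrite ger0_norm ?invr_ge0 ?ler0n// (parallelogram ip (L p) (L q)); lra.
have [|x ux] := cpl u.
  move=> e e0; have ce : 0 < (c * e) ^+ 2 / 4.
    by rewrite divr_gt0 ?exprn_gt0 ?mulr_gt0.
  have [n0 hn0] := inv_succ_small ce; exists n0 => p q hp hq.
  have := mid (u p) (u q).
  have Fe n : (n0 <= n)%N -> F (u n) < m + (c * e) ^+ 2 / 4.
    by move=> hn; rewrite (lt_trans (Fu n))// ltrD2l hn0.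
  have := Fe _ hp; have := Fe _ hq => h1 h2 h3.
  have {h1 h2 h3} h : N (L (u p - u q)) ^+ 2 < (c * e) ^+ 2 by lra.
  rewrite ltr_sqr ?nnegrE ?ipnorm_ge0 ?mulr_ge0 ?ltW// in h.
  by rewrite -(ltr_pM2l c0) (le_lt_trans (Lc _)).
exists x => v; apply/eqP; rewrite -subr_eq0 -modulus_eq0 eq_le modulus_ge0 andbT.
pose E y := ip (L v) (L y) - phi v.
pose K := 1 + N (L v) ^+ 2.
have K0 : 0 < K by rewrite ltr_wpDr ?sqr_ge0.
(* Moving from [u n] by [t v] with [t = - e^* / K] lowers [F] by at least [|e| ^ 2 / K], because [K]
   exceeds [N (L v) ^ 2]; yet [F (u n)] is within [1 / (n + 1)] of the infimum. *)
have euler n : modulus (E (u n)) ^+ 2 <= K * n.+1%:R^-1.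
  set e := E _; pose t := - (K^-1%:C%C * e^*).
  have := Fm (u n + t *: v); have := Fu n; rewrite /F => h1.
  rewrite (linearD L) (linearD phi) (linearZ_LR L) (linearZ_LR phi) /=.
  rewrite ipnorm_sqrDZ complexReD.
  have -> : ip (L v) (L (u n)) = e + phi v by rewrite /e /E subrK.
  rewrite mulrDr complexReD /t mulNr complexReN -[_ * e^* * e]mulrA [e^* * e]mulrC.
  rewrite mul_conj_modulus -rmorphM /= modulusN modulusM modulus_conj modulusC.
  rewrite ger0_norm ?invr_ge0 ?(ltW K0)// => h2.
  have h3 : (K^-1 * modulus e) ^+ 2 * N (L v) ^+ 2 <= K^-1 * modulus e ^+ 2.
    rewrite (_ : _ * _ = K^-1 * modulus e ^+ 2 * (N (L v) ^+ 2 / K)); last first.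
      by rewrite exprMn; ring.
    apply: ler_piMr; first by rewrite mulr_ge0 ?sqr_ge0// invr_ge0 ltW.
    by rewrite ler_pdivrMr// mul1r /K lerDr.
  have h4 : modulus e ^+ 2 * K^-1 < n.+1%:R^-1.
    move: h1 h2 h3; move: (n.+1%:R^-1) (complex.Re _) (complex.Re _) => eta r1 r2.
    by move: (K^-1) => w; lra.
  by rewrite ltr_pdivrMr// mulrC in h4; exact: ltW.
(* The residual at the limit differs from [E (u n)] by [<L v, L (u n - x)>], of modulus at most
   [N (L v) * a * e]. *)
apply: (@le0_of_le_mul _ _ (1 + N (L v) * a)) => e e0.
have [|n1 hn1] := @inv_succ_small (e ^+ 2 / K).
  by rewrite divr_gt0 ?exprn_gt0.
have [n2 hn2] := ux _ e0.
pose n := maxn n1 n2.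
have {hn1} h1 : modulus (E (u n)) <= e.
  rewrite -ler_sqr ?nnegrE ?modulus_ge0 ?(ltW e0)// (le_trans (euler _))//.
  by rewrite [K * _]mulrC -ler_pdivlMr// ltW// hn1// leq_maxl.
have {hn2} h2 : N (u n - x) < e by rewrite hn2// leq_maxr.
have -> : ip (L v) (L x) - phi v = E (u n) - ip (L v) (L (u n - x)).
  by rewrite /E (linearB L) linearBr; ring.
rewrite (le_trans (modulusD _ _))// modulusN mulrDl mul1r lerD//.
rewrite (le_trans (cauchy_schwarz _ _ _))// -mulrA ler_wpM2l ?ipnorm_ge0//.
by rewrite (le_trans (La _))// ler_pM2l// ltW.
Qed.

Lemma ip_inj u v : (forall x, ip x u = ip x v) -> u = v.
Proof.
by move=> h; apply/eqP; rewrite -subr_eq0 -(dnorm_eq0 ip) linearBr /= h subrr.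
Qed.

(** Riesz representation is the case of [least_squares] where [L] is the identity. The bound comes
    from [|Bs y| ^ 2 = <B (Bs y), y>]. Since [adjoint] selects its value by [xget], existence has to
    be supplied separately. *)
Lemma bounded_adjoint (B : {linear V -> V}) : ip_complete -> bounded B ->
  exists2 Bs : {linear V -> V}, bounded Bs & forall x y, ip (B x) y = ip x (Bs y).
Proof.
move=> cpl /bounded_gt0[M M0 BM].
have /choice[Bs BsE] y : exists z, forall x, ip (B x) y = ip x z.
  have [||||z hz] := @least_squares idfun (applyr ip y \o B) 1 (M * N y) cpl.
  - by exists 1 => x _; rewrite mul1r.
  - exact: ltr01.
  - by move=> x; rewrite mul1r.
  - move=> x /=; rewrite (le_trans (cauchy_schwarz _ _ _))//.
    by rewrite mulrAC ler_wpM2r ?ipnorm_ge0.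
  by exists z => x; rewrite hz.
have Bs_linear : linear Bs.
  move=> t y z; apply: ip_inj => x.
  by rewrite -BsE linearDr /= linearDr /= !ipZr !BsE.
pose BsL : {linear V -> V} := HB.pack Bs (GRing.isLinear.Build _ _ _ _ Bs Bs_linear).
exists BsL; last by move=> x y; rewrite BsE.
exists M => y _ /=; have [->|z0] := eqVneq (N (Bs y)) 0.
  by rewrite mulr_ge0 ?ipnorm_ge0 ?ltW.
have z_gt0 : 0 < N (Bs y) by rewrite lt_def z0 ipnorm_ge0.
rewrite -(ler_pM2l z_gt0).
have -> : N (Bs y) * N (Bs y) = modulus (ip (B (Bs y)) y).
  by rewrite BsE ip_ipnorm modulusC ger0_norm ?sqr_ge0// expr2.
rewrite (le_trans (cauchy_schwarz _ _ _))// mulrA ler_wpM2r ?ipnorm_ge0//.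
by rewrite mulrC BM.
Qed.

(** By Cauchy-Schwarz, [c |v| ^ 2 <= |L v| |M v| <= b |L v| |v|]. *)
Lemma coercive_lower_bound (L M : V -> V) (b c : R) :
  0 < c -> 0 < b -> (forall v, N (M v) <= b * N v) ->
  (forall v, c * N v ^+ 2 <= modulus (ip (L v) (M v))) ->
  forall v, c / b * N v <= N (L v).
Proof.
move=> c0 b0 Mb coer v.
have [->|v0] := eqVneq (N v) 0; first by rewrite mulr0 ipnorm_ge0.
have v_gt0 : 0 < N v by rewrite lt_def v0 ipnorm_ge0.
rewrite mulrAC ler_pdivrMr// -(ler_pM2r v_gt0) -mulrA -expr2.
rewrite (le_trans (coer v))// (le_trans (cauchy_schwarz _ _ _))// -mulrA.
by rewrite ler_wpM2l ?ipnorm_ge0.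
Qed.

(* Lax-Milgram: the least squares residual of the equation [L v = f] is
   orthogonal to the range of [L], hence vanishes. *)
Lemma coercive_surjective (L M : {linear V -> V}) (c : R) :
  ip_complete -> bounded L -> bounded M -> (forall f, exists v, M v = f) ->
  0 < c -> (forall v, c * N v ^+ 2 <= modulus (ip (L v) (M v))) ->
  forall f, exists v, L v = f.
Proof.
move=> cpl bL bM Msurj c0 coer f.
have [a a0 La] := bounded_gt0 bL; have [b b0 Mb] := bounded_gt0 bM.
have Lbelow := coercive_lower_bound c0 b0 Mb coer.
have [|||x hx] := @least_squares L (applyr ip f \o L) (c / b) (a * N f) cpl bL.
- by rewrite divr_gt0.
- exact: Lbelow.
- move=> y /=; rewrite (le_trans (cauchy_schwarz _ _ _))//.
  by rewrite mulrAC ler_wpM2r ?ipnorm_ge0.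
(* As [M] is onto, the residual is some [M v]; orthogonality to [L v] and coercivity force
   [v = 0]. *)
have [v hv] := Msurj (L x - f).
have orth : ip (L v) (M v) = 0 by rewrite hv linearBr /= hx subrr.
exists x; apply/eqP; rewrite -subr_eq0 -hv.
suff /eqP -> : v == 0 by rewrite linear0.
rewrite -(ipnorm_eq0 ip) -sqrf_eq0 eq_le sqr_ge0 andbT -(ler_pM2l c0) mulr0.
by rewrite (le_trans (coer v))// orth modulusC normr0.
Qed.

End Hilbert.

(** * Convergence in [ipnorm], usable on [V] and on [V * V] alike *)

Section Convergence.
Context {R : realType} {V : lmodType R[i]}.
Variable ip : {dot V for conjC}.
Local Notation N := (ipnorm ip).
Implicit Types (u v : nat -> V) (l k : V).

Definition ncvg u l :=
  forall e, 0 < e -> exists n0, forall n, (n0 <= n)%N -> N (u n - l) < e.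

Lemma ncvg_le u v l k (C : R) :
  (forall n, N (v n - k) <= C * N (u n - l)) -> ncvg u l -> ncvg v k.
Proof.
move=> h ul e e0; have C0 : 0 < `|C| + 1 by rewrite ltr_wpDl.
have [n0 hn0] := ul _ (divr_gt0 e0 C0); exists n0 => n hn.
rewrite (le_lt_trans (h n))// (@le_lt_trans _ _ ((`|C| + 1) * N (u n - l)))//.
  by rewrite ler_wpM2r ?ipnorm_ge0// (le_trans (ler_norm C))// lerDl.
by rewrite mulrC -ltr_pdivlMr// hn0.
Qed.

Lemma ncvgD u v l k : ncvg u l -> ncvg v k -> ncvg (fun n => u n + v n) (l + k).
Proof.
move=> ul vk e e0; have e2 : 0 < e / 2 by rewrite divr_gt0.
have [n1 h1] := ul _ e2; have [n2 h2] := vk _ e2.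
exists (maxn n1 n2) => n; rewrite geq_max => /andP[/h1 {}h1 /h2 {}h2].
rewrite opprD addrACA (le_lt_trans (ipnormD _ _ _))//; lra.
Qed.

Lemma ncvgZ (t : R[i]) u l : ncvg u l -> ncvg (fun n => t *: u n) (t *: l).
Proof.
by apply: (@ncvg_le _ _ _ _ (modulus t)) => n; rewrite -scalerBr ipnormZ lexx.
Qed.

Lemma ncvgB u v l k : ncvg u l -> ncvg v k -> ncvg (fun n => u n - v n) (l - k).
Proof.
move=> ul vk; apply: ncvgD => //.
by apply: (@ncvg_le _ _ _ _ 1) vk => n; rewrite -opprD ipnormN mul1r lexx.
Qed.

Lemma ncvg_bounded (f : {linear V -> V}) u l :
  bounded_operator ip (full_op f) -> ncvg u l -> ncvg (fun n => f (u n)) (f l).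
Proof.
by case=> M fM; apply: (@ncvg_le _ _ _ _ M) => n; rewrite -linearB; apply: fM.
Qed.

(** Split [P n (u n) = P n (u n - l) + P n l]: contractivity, uniform in [n], handles the first
    term, and strong convergence is used only at the fixed vector [l]. *)
Lemma ncvg_contraction (P : nat -> {linear V -> V}) u l :
  (forall n x, N (P n x) <= N x) -> ncvg (fun n => P n l) l -> ncvg u l ->
  ncvg (fun n => P n (u n)) l.
Proof.
move=> P1 Pl ul.
have h : ncvg (fun n => P n (u n) - P n l) 0.
  by apply: (@ncvg_le _ _ _ _ 1) ul => n; rewrite subr0 -linearB mul1r.
have := ncvgD h Pl; rewrite add0r; apply: (@ncvg_le _ _ _ _ 1) => n.
by rewrite subrK mul1r lexx.
Qed.

Lemma ncvg_ip u v l k (e : R) : ncvg u l -> ncvg v k -> 0 < e ->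
  exists n0, forall n, (n0 <= n)%N -> modulus (ip (u n) (v n) - ip l k) < e.
Proof.
move=> ul vk e0.
pose c := N l + N k + 1.
have c0 : 0 < c by rewrite ltr_wpDl// addr_ge0 ?ipnorm_ge0.
(* The entry [1] gives [N (v n) <= N k + 1]; the total error is then at most [d * c <= e / 2]. *)
pose d := Num.min 1 (e / c / 2).
have d0 : 0 < d by rewrite lt_min ltr01 !divr_gt0.
have [n1 h1] := ul _ d0; have [n2 h2] := vk _ d0.
exists (maxn n1 n2) => n; rewrite geq_max => /andP[/h1 {}h1 /h2 {}h2].
have -> : ip (u n) (v n) - ip l k = ip (u n - l) (v n) + ip l (v n - k).
  by rewrite linearBl linearBr /=; ring.
rewrite (le_lt_trans (modulusD _ _))//.
have hv : N (v n) <= N k + 1.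
  have := ipnormD ip (v n - k) k; rewrite subrK => hv; rewrite (le_trans hv)//.
  by rewrite addrC lerD2l (le_trans (ltW h2))// ge_min lexx.
have h3 := le_trans (cauchy_schwarz _ _ _)
  (ler_pM (ipnorm_ge0 _ _) (ipnorm_ge0 _ _) (ltW h1) hv).
have h4 := le_trans (cauchy_schwarz _ _ _) (ler_wpM2l (ipnorm_ge0 _ l) (ltW h2)).
have h5 : d * c <= e / 2 by rewrite -ler_pdivlMr// mulrAC ge_min lexx orbT.
rewrite (le_lt_trans (lerD h3 h4))// (@le_lt_trans _ _ (e / 2))//; last lra.
by rewrite (le_trans _ h5)// /c; lra.
Qed.

End Convergence.

(** * From the topology of [H] to [ipnorm] *)

Section HilbertComplete.
Context {R : realType} {H : completeNormedModType R[i]}.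
Variable ip : {dot H for conjC}.
Hypothesis ip_norm : forall x : H, `|x| ^+ 2 = ip x x.

Lemma normr_ipnorm (x : H) : `|x| = (ipnorm ip x)%:C%C.
Proof.
apply/eqP; rewrite -(eqrXn2 (n := 2))//; last by rewrite ler0c ipnorm_ge0.
by rewrite ip_norm ip_ipnorm rmorphXn.
Qed.

Lemma cvg_ncvg (u : nat -> H) (l : H) : u n @[n --> \oo] --> l -> ncvg ip u l.
Proof.
move=> /cvgrPdist_lt ul e e0; have /ul : 0 < e%:C%C :> R[i] by rewrite ltcR.
case=> n0 _ h; exists n0 => n /h /=.
by rewrite normr_ipnorm ltcR ipnormB.
Qed.

Lemma ip_complete_hilbert : ip_complete ip.
Proof.
move=> u uC.
have /cauchy_cvg ul : cauchy (u n @[n --> \oo]).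
  apply/cauchy_ballP => e e0.
  (* Radii of balls lie in [R[i]]; a positive one is real. *)
  have e1 : 0 < complex.Re e by move: e0; rewrite ltcE => /andP[].
  have eE : e = (complex.Re e)%:C%C by rewrite RRe_real// gtr0_real.
  have [n0 hn0] := uC _ e1.
  exists (u @` [set n | (n0 <= n)%N], u @` [set n | (n0 <= n)%N]).
    by split; exists n0 => // n hn; exists n.
  case=> _ _ /= [[p hp <-] [q hq <-]].
  by rewrite -ball_normE /= normr_ipnorm eE ltcR hn0.
by exists (lim (u n @[n --> \oo])); apply: cvg_ncvg.
Qed.

End HilbertComplete.

(** * The Hilbert direct sum and its block maps *)

Section ProductSpace.
Context {R : realType} {V : lmodType R[i]}.
Variable ip : {dot V for conjC}.
Local Notation N := (ipnorm ip).
Local Notation ip2 := (prod_dot ip).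
Local Notation N2 := (ipnorm (prod_dot ip)).

Lemma prod_ipnorm_sqr (z : V * V) : N2 z ^+ 2 = N z.1 ^+ 2 + N z.2 ^+ 2.
Proof.
apply: complexI; rewrite rmorphD /= -!ip_ipnorm //.
Qed.

Lemma ipnorm_fst_le (z : V * V) : N z.1 <= N2 z.
Proof.
by rewrite -ler_sqr ?nnegrE ?ipnorm_ge0// prod_ipnorm_sqr lerDl sqr_ge0.
Qed.

Lemma ipnorm_snd_le (z : V * V) : N z.2 <= N2 z.
Proof.
by rewrite -ler_sqr ?nnegrE ?ipnorm_ge0// prod_ipnorm_sqr lerDr sqr_ge0.
Qed.

Lemma prod_ipnorm_le (z : V * V) : N2 z <= N z.1 + N z.2.
Proof.
rewrite -ler_sqr ?nnegrE ?addr_ge0 ?ipnorm_ge0// prod_ipnorm_sqr sqrrD.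
by have := mulr_ge0 (ipnorm_ge0 ip z.1) (ipnorm_ge0 ip z.2); lra.
Qed.

Lemma ncvg_pair (u : nat -> V * V) (l : V * V) :
  ncvg ip (fun n => (u n).1) l.1 -> ncvg ip (fun n => (u n).2) l.2 ->
  ncvg ip2 u l.
Proof.
move=> u1 u2 e e0; have e2 : 0 < e / 2 by rewrite divr_gt0.
have [n1 h1] := u1 _ e2; have [n2 h2] := u2 _ e2.
exists (maxn n1 n2) => n; rewrite geq_max => /andP[/h1 {}h1 /h2 {}h2].
by rewrite (le_lt_trans (prod_ipnorm_le _))//=; lra.
Qed.

Lemma ip_complete_prod : ip_complete ip -> ip_complete ip2.
Proof.
move=> cpl u uC.
have [|l1 h1] := cpl (fun n => (u n).1).
  move=> e /uC[n0 hn0]; exists n0 => p q hp hq.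
  exact: le_lt_trans (ipnorm_fst_le (u p - u q)) (hn0 _ _ hp hq).
have [|l2 h2] := cpl (fun n => (u n).2).
  move=> e /uC[n0 hn0]; exists n0 => p q hp hq.
  exact: le_lt_trans (ipnorm_snd_le (u p - u q)) (hn0 _ _ hp hq).
by exists (l1, l2); apply: ncvg_pair.
Qed.

(** An everywhere defined counterpart of [block_op], to which the variational lemmas for linear maps
    apply. *)
Definition block_map (a b c d : V -> V) (z : V * V) : V * V :=
  (a z.1 + b z.2, c z.1 + d z.2).

Lemma block_map_linear (a b c d : {linear V -> V}) : linear (block_map a b c d).
Proof.
move=> t x y; apply/pair_equal_spec; rewrite /=.
rewrite (linearP a) (linearP b) (linearP c) (linearP d).
split; rewrite addrACA scalerDr; reflexivity.
Qed.

HB.instance Definition _ (a b c d : {linear V -> V}) :=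
  GRing.isLinear.Build _ _ _ _ (block_map a b c d) (block_map_linear a b c d).

Lemma bounded_block_map (a b c d : V -> V) :
  bounded_operator ip (full_op a) -> bounded_operator ip (full_op b) ->
  bounded_operator ip (full_op c) -> bounded_operator ip (full_op d) ->
  bounded_operator ip2 (full_op (block_map a b c d)).
Proof.
move=> /bounded_gt0[ma ma0 ha] /bounded_gt0[mb mb0 hb].
move=> /bounded_gt0[mc mc0 hc] /bounded_gt0[md md0 hd].
exists (ma + mb + mc + md) => z _ /=.
rewrite (le_trans (prod_ipnorm_le _))//=.
have h1 := ipnormD ip (a z.1) (b z.2); have h2 := ipnormD ip (c z.1) (d z.2).
have := ha z.1; have := hb z.2; have := hc z.1; have := hd z.2.
have := ler_wpM2l (ltW ma0) (ipnorm_fst_le z).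
have := ler_wpM2l (ltW mb0) (ipnorm_snd_le z).
have := ler_wpM2l (ltW mc0) (ipnorm_fst_le z).
have := ler_wpM2l (ltW md0) (ipnorm_snd_le z).
rewrite !mulrDl; lra.
Qed.

(* Pairing with [(x, - y)] makes the off-diagonal terms cancel. *)
Lemma saddle_lower_bound (gA gD : R) (s : R[i]) (x y ax b1 b2 d : V) :
  - gD < complex.Re s < gA ->
  gA * N x ^+ 2 <= complex.Re (ip ax x) ->
  complex.Re (ip d y) <= - gD * N y ^+ 2 ->
  complex.Re (ip b1 x) = complex.Re (ip b2 y) ->
  strip_gap gA gD s * N2 (x, y) <= N2 (ax + b1 - s *: x, b2 + d - s *: y).
Proof.
move=> /andP[sD sA] hA hD hB; set w := (ax + _ - _, _).
have [->|z0] := eqVneq (N2 (x, y)) 0; first by rewrite mulr0 ipnorm_ge0.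
have z_gt0 : 0 < N2 (x, y) by rewrite lt_def z0 ipnorm_ge0.
rewrite -(ler_pM2r z_gt0) -mulrA -expr2.
have -> : N2 (x, y) = N2 (x, - y).
  by apply/eqP; rewrite -(eqrXn2 (n := 2)) ?ipnorm_ge0// !prod_ipnorm_sqr /= ipnormN.
rewrite (le_trans _ (cauchy_schwarz ip2 w (x, - y)))//.
rewrite (le_trans _ (Re_le_modulus _))// prod_ipnorm_sqr /= ipnormN /prod_dot /=.
rewrite !linearBl !linearDl !linearNr /= !ipZl !ip_ipnorm !(complexReD, complexReN).
rewrite ![s * _]mulrC !complexRe_realM hB.
have h1 : strip_gap gA gD s <= gA - complex.Re s by rewrite ge_min lexx.
have h2 : strip_gap gA gD s <= gD + complex.Re s by rewrite ge_min lexx orbT.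
have := ler_wpM2r (sqr_ge0 (N x)) h1; have := ler_wpM2r (sqr_ge0 (N y)) h2; lra.
Qed.

End ProductSpace.

(** * Partially defined linear operators *)

Section OperatorLemmas.
Context {R : realType} {V : lmodType R[i]}.
Variable ip : {dot V for conjC}.
Local Notation N := (ipnorm ip).

Lemma inverse_opK (T : operator V) x :
  (forall y z, dom T y -> dom T z -> T y = T z -> y = z) ->
  dom T x -> inverse_op T (T x) = x.
Proof. by move=> inj Tx; apply: xget_unique => // y [Ty /inj]; apply. Qed.

(** Two candidates for the adjoint value differ by a vector of the domain, so the difference may
    serve as test vector and is orthogonal to itself. *)
Lemma adjoint_eq (T : operator V) y z :
  (forall u v, dom T u -> dom T v -> dom T (u - v)) ->
  dom T z -> (forall x, dom T x -> ip (T x) y = ip x z) -> adjoint ip T y = z.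
Proof.
move=> domB Tz hz; apply: xget_unique => // z' [Tz' hz'].
apply/eqP; rewrite -subr_eq0 -(dnorm_eq0 ip) linearBr /=.
by rewrite -hz' ?hz ?subrr//; apply: domB.
Qed.

Lemma linear_operator_shift (T : operator V) (t : R[i]) :
  linear_operator T -> linear_operator (shift_op T t).
Proof.
case=> T0 TL; split=> // a x y Tx Ty; have [Txy Te] := TL a x y Tx Ty.
by split=> //=; rewrite Te scalerDr opprD scalerBr !scalerA mulrC addrACA.
Qed.

Lemma full_op_linear (f : {linear V -> V}) : linear_operator (full_op f).
Proof. by split=> // a x y _ _; split=> //=; rewrite linearP. Qed.

Lemma block_op_linear (A B C D : operator V) :
  linear_operator A -> linear_operator B -> linear_operator C ->
  linear_operator D -> linear_operator (block_op A B C D).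
Proof.
move=> [A0 AL] [B0 BL] [C0 CL] [D0 DL]; split=> //.
move=> a x y [[Ax Cx] [Bx Dx]] [[Ay Cy] [By Dy]].
have [Axy Ae] := AL a _ _ Ax Ay; have [Bxy Be] := BL a _ _ Bx By.
have [Cxy Ce] := CL a _ _ Cx Cy; have [Dxy De] := DL a _ _ Dx Dy.
split=> //; apply/pair_equal_spec; rewrite /= Ae Be Ce De !scalerDr.
by split; rewrite addrACA.
Qed.

Lemma linear_operatorZ (T : operator V) (t : R[i]) x : linear_operator T ->
  dom T x -> dom T (t *: x) /\ T (t *: x) = t *: T x.
Proof.
case=> T0 TL Tx.
have [_] := TL 1 0 0 T0 T0; rewrite scaler0 scale1r addr0.
move=> /(congr1 (fun y => y - T 0)); rewrite subrr addrK => /esym T00.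
by have := TL t x 0 Tx T0; rewrite T00 !addr0.
Qed.

Lemma linear_operatorB (T : operator V) x y : linear_operator T ->
  dom T x -> dom T y -> dom T (x - y) /\ T (x - y) = T x - T y.
Proof.
move=> TL Tx Ty; have := TL.2 (-1) y x Ty Tx.
by rewrite !scaleN1r addrC [- T y + _]addrC.
Qed.

Lemma linear_operator_inj (T : operator V) (c : R) : linear_operator T ->
  0 < c -> (forall x, dom T x -> c * N x <= N (T x)) ->
  forall x y, dom T x -> dom T y -> T x = T y -> x = y.
Proof.
move=> TL c0 Tc x y Tx Ty Txy; apply/eqP; rewrite -subr_eq0 -(ipnorm_eq0 ip).
have [Tdom Teq] := linear_operatorB TL Tx Ty.
rewrite eq_le ipnorm_ge0 andbT -(ler_pM2l c0) mulr0 (le_trans (Tc _ Tdom))//.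
by rewrite Teq Txy subrr ipnorm0.
Qed.

(** Removes the normalisation [N (T z) = 1]: both sides are quadratic in [z], and [<z, T z> - nu |T
    z| ^ 2 = <z - nu T z, T z>]. *)
Lemma numerical_range_homogeneous (T : operator V) (nu : R[i]) (d : R) :
  linear_operator T ->
  (forall z, dom T z -> N (T z) = 1 -> d <= modulus (ip z (T z) - nu)) ->
  forall z, dom T z -> d * N (T z) ^+ 2 <= modulus (ip (z - nu *: T z) (T z)).
Proof.
move=> TL hd z Tz; have [->|r0] := eqVneq (N (T z)) 0.
  by rewrite expr0n mulr0 modulus_ge0.
have r_gt0 : 0 < N (T z) by rewrite lt_def r0 ipnorm_ge0.
set r := N (T z) in r0 r_gt0 *.
have [Tz' Tz'E] := linear_operatorZ (r^-1)%:C%C TL Tz.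
have N1 : N (T ((r^-1)%:C%C *: z)) = 1.
  by rewrite Tz'E ipnormZ modulusC ger0_norm ?invr_ge0 ?(ltW r_gt0)// mulVf.
rewrite -ler_pdivlMr ?exprn_gt0// (le_trans (hd _ Tz' N1))// Tz'E.
have -> : ip ((r^-1)%:C%C *: z) ((r^-1)%:C%C *: T z) - nu =
          (r ^- 2)%:C%C * ip (z - nu *: T z) (T z).
  rewrite ipZl ipZr ipBl ipZl ip_ipnorm -/r mulrBr mulrA mul_conj_modulus.
  rewrite modulusC ger0_norm ?invr_ge0 ?(ltW r_gt0)// exprVn; congr (_ - _).
  by rewrite mulrCA -rmorphM /= mulVf ?mulr1// expf_neq0.
rewrite modulusM modulusC ger0_norm ?invr_ge0 ?exprn_ge0 ?(ltW r_gt0)//.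
by rewrite mulrC.
Qed.

(** The inverse has norm at most [eps^-1], and the pseudospectrum asks for a strictly larger one. *)
Lemma not_pseudospectrum (T : operator V) (eps : R) (lambda : R[i]) :
  0 < eps -> linear_operator T ->
  (forall y, exists2 x, dom T x & T x - lambda *: x = y) ->
  (forall x, dom T x -> eps * N x <= N (T x - lambda *: x)) ->
  ~ pseudospectrum ip eps T lambda.
Proof.
move=> eps0 TL surj lb; pose S := shift_op T lambda.
have inj := linear_operator_inj (linear_operator_shift lambda TL) eps0 lb.
have inv_le y : N (inverse_op S y) <= eps^-1 * N y.
  have [x Tx <-] := surj y; rewrite (inverse_opK inj Tx).
  by rewrite mulrC ler_pdivlMr// mulrC lb.
have res : resolvent_set ip T lambda.
  split; last by exists eps^-1 => y _.
  split=> //; first by move=> x y; rewrite !inE; apply: inj.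
  by move=> y _; have [x Tx hx] := surj y; exists x.
case=> [/(_ res)//|[_]]; apply/negP; rewrite -leNgt; apply: ge_sup.
  (* The bound on a supremum needs a nonempty set; the vector [0] belongs to the unit ball. *)
  exists (N (inverse_op S 0)), 0 => //; split=> /=; last by rewrite ipnorm0.
  by have [x Tx hx] := surj 0; exists x.
move=> _ [y [_ y1] <-]; rewrite (le_trans (inv_le y))//.
by rewrite ler_piMr// invr_ge0 ltW.
Qed.

End OperatorLemmas.

(** * Stability of boundedness under algebraic operations *)

Section BoundedMaps.
Context {R : realType} {V : lmodType R[i]}.
Variable ip : {dot V for conjC}.
Local Notation N := (ipnorm ip).
Local Notation bounded f := (bounded_operator ip (full_op f)).

Lemma bounded_id : bounded idfun.
Proof. by exists 1 => x _; rewrite mul1r. Qed.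

Lemma bounded0 : bounded \0.
Proof. by exists 0 => x _; rewrite /= ipnorm0 mul0r. Qed.

Lemma boundedD f g : bounded f -> bounded g -> bounded (f \+ g).
Proof.
case=> a ha [b hb]; exists (a + b) => x _ /=; rewrite mulrDl.
by rewrite (le_trans (ipnormD _ _ _))// lerD ?ha ?hb.
Qed.

Lemma boundedZ t f : bounded f -> bounded (t \*: f).
Proof.
case=> a ha; exists (modulus t * a) => x _ /=.
by rewrite ipnormZ -mulrA ler_wpM2l ?modulus_ge0 ?ha.
Qed.

Lemma boundedN f : bounded f -> bounded (\- f).
Proof. by case=> a ha; exists a => x _ /=; rewrite ipnormN ha. Qed.

Lemma boundedB f g : bounded f -> bounded g -> bounded (f \- g).
Proof. by move=> bf bg; apply: (boundedD bf (boundedN bg)). Qed.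

Lemma bounded_comp f g : bounded f -> bounded g -> bounded (f \o g).
Proof.
move=> /bounded_gt0[a a0 ha] /bounded_gt0[b b0 hb]; exists (a * b) => x _ /=.
by rewrite (le_trans (ha _))// -mulrA ler_wpM2l ?hb ?ltW.
Qed.

End BoundedMaps.

(** * Surjectivity, lower bounds and pseudospectrum of the block operator *)

Section BlockOperator.
Context {R : realType} {V : lmodType R[i]}.
Variables (ip : {dot V for conjC}) (A : operator V) (Ai B Bs D : {linear V -> V}).
Variables (gA gD : R) (s : R[i]).
Local Notation N := (ipnorm ip).
Local Notation ip2 := (prod_dot ip).
Local Notation N2 := (ipnorm (prod_dot ip)).
Local Notation bounded f := (bounded_operator ip (full_op f)).
Local Notation cA := (block_op A (full_op B) (full_op Bs) (full_op D)).
Local Notation T := (shift_op cA s).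
Local Notation g := (strip_gap gA gD s).

Hypothesis cpl : ip_complete ip.
Hypothesis A_linear : linear_operator A.
Hypothesis Ai_dom : forall u, dom A (Ai u).
Hypothesis A_AiK : forall u, A (Ai u) = u.
Hypotheses (bAi : bounded Ai) (bB : bounded B) (bBs : bounded Bs) (bD : bounded D).
Hypothesis adj : forall x y, ip (B x) y = ip x (Bs y).
Hypothesis A_accretive : forall x, dom A x ->
  complex.Re (ip (A x) x) >= gA * N x ^+ 2.
Hypothesis D_dissipative : forall x, complex.Re (ip (D x) x) <= - gD * N x ^+ 2.
Hypothesis gA_gt0 : 0 < gA.
Hypothesis s_strip : - gD < complex.Re s < gA.

(* [L lambda v = (cA - lambda) (Z v)]; precomposing with [Z], whose range is the
   domain of [cA], turns the unbounded problem into a bounded one. *)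
Let Z := block_map Ai \0 \0 idfun.
Let L lambda := block_map (idfun \- lambda \*: Ai) B (Bs \o Ai)
  (D \- lambda \*: idfun).

Let g_gt0 : 0 < g.
Proof. by case/andP: s_strip => h1 h2; rewrite lt_min !subr_gt0 h2 -ltrBlDl sub0r. Qed.

Let dom_Z v : dom cA (Z v).
Proof. by rewrite /= addr0. Qed.

Let L_Z lambda v : shift_op cA lambda (Z v) = L lambda v.
Proof.
apply/pair_equal_spec; rewrite /= !addr0 !add0r A_AiK.
by split; [rewrite addrAC | rewrite addrA].
Qed.

Let bounded_L lambda : bounded_operator ip2 (full_op (L lambda)).
Proof.
apply: bounded_block_map => //.
- by apply: boundedB; [exact: bounded_id | exact: boundedZ].
- exact: bounded_comp.
- by apply: boundedB => //; apply: boundedZ; apply: bounded_id.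
Qed.

Let cA_linear : linear_operator cA.
Proof. by apply: block_op_linear => //; apply: full_op_linear. Qed.

Lemma block_op_lower_bound z : dom cA z -> g * N2 z <= N2 (T z).
Proof.
case: z => x y [[/= Ax _] _]; apply: saddle_lower_bound => //=.
- exact: A_accretive.
- by rewrite adj ip_conj complexRe_conj.
Qed.

(** Pairing with [(x, - y)], where [x = Ai u], controls [x] and [y] but not [u = A x]. Replacing [x]
    by [x + tau u] gains [tau |u| ^ 2], and for small [tau] the new cross terms are absorbed. *)
Lemma block_op_coercive : exists M : {linear (V * V)%type -> (V * V)%type}, exists c : R,
  [/\ bounded_operator ip2 (full_op M), forall f, exists v, M v = f, 0 < c &
  forall v, c * N2 v ^+ 2 <= modulus (ip2 (L s v) (M v))].
Proof.
have [b b0 hb] := bounded_gt0 bB.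
pose k := modulus s + b.
have k0 : 0 < k by rewrite ltr_wpDl ?modulus_ge0.
(* Chosen so that [tau k ^ 2 = g / 2]: the cross terms are at most [tau k (|x| + |y|) |u|], hence at
   most [g / 2 (|x| ^ 2 + |y| ^ 2) + tau / 2 |u| ^ 2]. *)
pose tau := g / (2 * k ^+ 2).
have tau0 : 0 < tau by rewrite divr_gt0// mulr_gt0// exprn_gt0.
pose M0 : {linear V -> V} := Ai \+ tau%:C%C \*: idfun.
have bM0 : bounded M0.
  by apply: boundedD => //; apply: boundedZ; apply: bounded_id.
have Re_Ai u : gA * N (Ai u) ^+ 2 <= complex.Re (ip u (Ai u)).
  by have := A_accretive (Ai_dom u); rewrite A_AiK.
(* [Ai] inherits accretivity from [A], so [Ai + tau] is coercive against the identity. *)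
have M0_surj : forall f, exists v, M0 v = f.
  apply: (@coercive_surjective _ _ ip M0 idfun tau) => //.
  - exact: bounded_id.
  - by move=> f; exists f.
  move=> v; rewrite (le_trans _ (Re_le_modulus _))//= linearDl /= complexReD.
  rewrite ipZl complexRe_realM ip_ipnorm /= lerDr ip_conj complexRe_conj.
  by rewrite (le_trans _ (Re_Ai v))// mulr_ge0 ?sqr_ge0 ?ltW.
(* Half of [g] and half of [tau] survive the absorption. *)
exists (block_map M0 \0 \0 (\- idfun)), (Num.min g tau / 2); split.
- apply: bounded_block_map => //; try exact: bounded0.
  by apply: boundedN; apply: bounded_id.
- move=> [f1 f2]; have [v <-] := M0_surj f1; exists (v, - f2).
  by rewrite /= /block_map /= addr0 add0r opprK.
- by rewrite divr_gt0// lt_min g_gt0.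
case=> u y; rewrite (le_trans _ (Re_le_modulus _))//.
rewrite /L /= /block_map /prod_dot /= addr0 add0r.
pose x := Ai u; rewrite -/x prod_ipnorm_sqr /=.
rewrite ipDr ipZr ipNr.
have -> : u - s *: x + B y = (u + B y) - s *: x by rewrite addrAC.
have -> : Bs x + (D y - s *: y) = (Bs x + D y) - s *: y by rewrite addrA.
have -> : (tau%:C%C : R[i])^* = tau%:C%C by apply/eqP; rewrite eq_complex /= oppr0 !eqxx.
rewrite !ipBl !ipDl !ipZl !ip_ipnorm !(complexReD, complexReN).
rewrite complexRe_realM !(complexReD, complexReN) /=.
rewrite ![s * _%:C%C]mulrC !complexRe_realM.
have h1 := Re_Ai u; rewrite -/x in h1.
have h2 := D_dissipative y.
have h3 : complex.Re (ip (B y) x) = complex.Re (ip (Bs x) y).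
  by rewrite adj ip_conj complexRe_conj.
have h4 : - (b * N y * N u) <= complex.Re (ip (B y) u).
  rewrite (le_trans _ (Re_ge_modulus _))// lerN2.
  by rewrite (le_trans (cauchy_schwarz _ _ _))// ler_wpM2r ?ipnorm_ge0.
have h5 : complex.Re (s * ip x u) <= modulus s * N x * N u.
  rewrite (le_trans (Re_le_modulus _))// modulusM -mulrA.
  by rewrite ler_wpM2l ?modulus_ge0// cauchy_schwarz.
have h6 : g * N x ^+ 2 <= (gA - complex.Re s) * N x ^+ 2.
  by rewrite ler_wpM2r ?sqr_ge0// ge_min lexx.
have h7 : g * N y ^+ 2 <= (gD + complex.Re s) * N y ^+ 2.
  by rewrite ler_wpM2r ?sqr_ge0// ge_min lexx orbT.
have h8 : tau * (modulus s * N x * N u + b * N y * N u) <=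
          g / 2 * (N x ^+ 2 + N y ^+ 2) + tau / 2 * N u ^+ 2.
  have -> : g / 2 = tau * k ^+ 2.
    by rewrite /tau; field; rewrite gt_eqF.
  have : modulus s * N x * N u + b * N y * N u <= k * (N x + N y) * N u.
    have := mulr_ge0 (mulr_ge0 (modulus_ge0 s) (ipnorm_ge0 ip y)) (ipnorm_ge0 ip u).
    have := mulr_ge0 (mulr_ge0 (ltW b0) (ipnorm_ge0 ip x)) (ipnorm_ge0 ip u).
    by rewrite /k; lra.
  have : k * (N x + N y) * N u <= k ^+ 2 * (N x ^+ 2 + N y ^+ 2) + N u ^+ 2 / 2.
    have := sqr_ge0 (k * N x - N u / 2); have := sqr_ge0 (k * N y - N u / 2); lra.
  move=> a1 a2; have := ler_wpM2l (ltW tau0) (le_trans a2 a1); lra.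
have h9 : Num.min g tau / 2 * (N u ^+ 2 + N y ^+ 2) <=
          g / 2 * N y ^+ 2 + tau / 2 * N u ^+ 2.
  rewrite mulrDr addrC lerD// ler_wpM2r ?sqr_ge0// ler_wpM2r// ge_min lexx//.
  by rewrite orbT.
have h10 := ler_wpM2l (ltW tau0) h4; have h11 := ler_wpM2l (ltW tau0) h5.
have h12 : 0 <= g / 2 * N x ^+ 2 by rewrite mulr_ge0 ?sqr_ge0// divr_ge0// ltW.
lra.
Qed.

Lemma pseudospectrum_near_range (eps : R) (lambda : R[i]) :
  0 < eps -> eps < g -> pseudospectrum ip2 eps cA lambda ->
  lambda != s /\ exists z, [/\ dom cA z, N2 (T z) = 1 &
    modulus (ip2 z (T z) - (lambda - s)^-1) < eps / (g ^+ 2 - eps * g)].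
Proof.
move=> eps0 epsg hlam.
have cpl2 := ip_complete_prod cpl.
have [M [c [bM M_surj c0 LMc]]] := block_op_coercive.
have Ls_surj := coercive_surjective cpl2 (bounded_L s) bM M_surj c0 LMc.
have surj_of l : (forall f, exists v, L l v = f) ->
    forall y, exists2 x, dom cA x & cA x - l *: x = y.
  by move=> h y; have [v <-] := h y; exists (Z v) => //; rewrite -L_Z.
(* At [lambda = s] the operator is onto and bounded below by [g > eps]. *)
have lams : lambda != s.
  apply/eqP => lams; rewrite lams in hlam.
  apply: not_pseudospectrum hlam => //; first exact: surj_of.
  move=> x Ax; rewrite (le_trans _ (block_op_lower_bound Ax))//.
  by rewrite ler_wpM2r ?ipnorm_ge0// ltW.
split=> //; set mu := lambda - s; have mu0 : mu != 0 by rewrite subr_eq0.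
set d := eps / _.
have gg : 0 < g ^+ 2 - eps * g by rewrite expr2 -mulrBl mulr_gt0 ?subr_gt0.
have d0 : 0 < d by rewrite divr_gt0.
apply: contrapT => none.
have far z : dom cA z -> d * N2 (T z) ^+ 2 <= modulus (ip2 (z - mu^-1 *: T z) (T z)).
  have TL := linear_operator_shift s cA_linear.
  apply: (@numerical_range_homogeneous _ _ ip2 T mu^-1 d TL) => x Ax x1.
  rewrite leNgt; apply/negP => hx.
  by apply: none; exists x.
have shiftE z : cA z - lambda *: z = T z - mu *: z.
  by rewrite /= /mu scalerBl opprB addrA subrK.
have farT z : dom cA z -> modulus mu * (d * N2 (T z) ^+ 2) <=
    modulus (ip2 (cA z - lambda *: z) (T z)).
  move=> Az; have -> : cA z - lambda *: z = (- mu) *: (z - mu^-1 *: T z).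
    by rewrite shiftE scaleNr scalerBr scalerA divff// scale1r opprB.
  have -> : ip2 ((- mu) *: (z - mu^-1 *: T z)) (T z) =
      - mu * ip2 (z - mu^-1 *: T z) (T z) by exact: ipZl.
  by rewrite modulusM modulusN ler_wpM2l ?modulus_ge0 ?far.
have md0 : 0 < modulus mu * d by rewrite mulr_gt0 ?modulus_gt0.
apply: not_pseudospectrum hlam => //.
- apply: surj_of; have [b b0 Mb] := bounded_gt0 bM.
  have low := coercive_lower_bound c0 b0 Mb LMc.
  (* Since [T (Z v) = L s v], [farT] bounds the pairing below by [|mu| d |L s v| ^ 2], and
     [|L s v| >= (c / b) |v|]. *)
  apply: (@coercive_surjective _ _ ip2 (L lambda) (L s)
    (modulus mu * d * (c / b) ^+ 2)) => //.
  + exact: bounded_L.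
  + exact: bounded_L.
  + by rewrite mulr_gt0// exprn_gt0// divr_gt0.
  move=> v; have := farT _ (dom_Z v).
  rewrite -[cA (Z v) - _]/(shift_op cA lambda (Z v)) !L_Z; apply: le_trans.
  rewrite -[leLHS]mulrA -[leLHS]mulrA ler_wpM2l ?modulus_ge0//.
  rewrite ler_wpM2l ?(ltW d0)// -exprMn ler_sqr ?nnegrE ?ipnorm_ge0//.
  by rewrite mulr_ge0 ?ipnorm_ge0// divr_ge0 ?ltW.
(* A violating [z] satisfies [|mu| |z| >= |T z| - eps |z| >= (g - eps) |z|]. Then [farT] gives [|(T
   - mu) z| >= |mu| d |T z| >= d g (g - eps) |z| = eps |z|], a contradiction. *)
- move=> z Az; rewrite leNgt; apply/negP => hz.
  have zT := block_op_lower_bound Az.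
  have z0 : 0 < N2 z.
    rewrite lt_def ipnorm_ge0 andbT; apply: contraTneq hz => ->.
    by rewrite mulr0 -leNgt ipnorm_ge0.
  have T0 : 0 < N2 (T z) by rewrite (lt_le_trans _ zT)// mulr_gt0.
  have h1 : modulus mu * (d * N2 (T z)) <= N2 (cA z - lambda *: z).
    rewrite -(ler_pM2r T0); apply: le_trans (cauchy_schwarz ip2 _ _).
    by rewrite -mulrA -mulrA -expr2; apply: farT.
  have h2 : (g - eps) * N2 z <= modulus mu * N2 z.
    have := lerB_ipnorm ip2 (T z) (mu *: z); rewrite -shiftE ipnormZ; lra.
  have h3 : d * (g * ((g - eps) * N2 z)) <= modulus mu * (d * N2 (T z)).
    have ge : g - eps <= modulus mu by rewrite -(ler_pM2r z0).
    rewrite [leRHS]mulrCA ler_wpM2l ?(ltW d0)// mulrCA.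
    by rewrite ler_pM ?mulr_ge0 ?ipnorm_ge0 ?subr_ge0 ?(ltW epsg) ?(ltW g_gt0).
  have h4 : d * (g * ((g - eps) * N2 z)) = eps * N2 z.
    by rewrite /d; field; rewrite gt_eqF.
  by have := le_lt_trans (le_trans h3 h1) hz; rewrite h4 ltxx.
Qed.

End BlockOperator.

(** * The inverse of [A] as a bounded linear map *)

Section BoundedInverse.
Context {R : realType} {V : lmodType R[i]}.
Variable ip : {dot V for conjC}.
Local Notation N := (ipnorm ip).

Lemma shift_op0 (A : operator V) : shift_op A 0 = A.
Proof.
case: A => d f; rewrite /shift_op /=; congr Operator.
by apply/funext => x; rewrite scale0r subr0.
Qed.

Lemma inverse_op_linear (A : operator V) :
  linear_operator A -> resolvent_set ip A 0 ->
  exists Ai : {linear V -> V}, [/\ bounded_operator ip (full_op Ai),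
    Ai =1 inverse_op A, forall u, dom A (Ai u), forall u, A (Ai u) = u &
    forall x, dom A x -> Ai (A x) = x].
Proof.
move=> AL [bij [b hb]]; rewrite shift_op0 in bij hb.
have [_ Ainj Asurj] := bij.
have inj y z : dom A y -> dom A z -> A y = A z -> y = z.
  by move=> Ay Az; apply: Ainj; rewrite inE.
have invP u : dom A (inverse_op A u) /\ A (inverse_op A u) = u.
  by have [x Ax <-] := Asurj u I; rewrite inverse_opK.
have inv_linear : linear (inverse_op A).
  move=> t u v; have [du Au] := invP u; have [dv Av] := invP v.
  have [dom_uv A_uv] := AL.2 t _ _ du dv.
  by rewrite -{1}Au -{1}Av -A_uv inverse_opK.
pose Ai : {linear V -> V} :=
  HB.pack (app (inverse_op A))
    (GRing.isLinear.Build _ _ _ _ (app (inverse_op A)) inv_linear).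
exists Ai; split => //.
- by exists b => x _; apply: hb; have [y Ay <-] := Asurj x I; exists y.
- by move=> u; case: (invP u).
- by move=> u; case: (invP u).
- by move=> x Ax; apply: inverse_opK.
Qed.

End BoundedInverse.

(** * Orthogonal projections and compressions to their ranges *)

Section OrthogonalProjection.
Context {R : realType} {V : lmodType R[i]}.
Variables (ip : {dot V for conjC}) (P : {linear V -> V}).
Hypothesis P_orth : orthogonal_projection ip P.
Local Notation N := (ipnorm ip).

(** [u - P u] lies in the kernel, which is orthogonal to the range, so both sides equal
    [<P x, P y>]. *)
Lemma projection_self_adjoint x y : ip (P x) y = ip x (P y).
Proof.
case: P_orth => PP orth.
have h u v : ip (P u) (P v) = ip u (P v).
  apply/eqP; rewrite eq_sym -subr_eq0 -ipBl orth//.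
  by rewrite linearB /= PP subrr.
by rewrite -h ip_conj -h -ip_conj.
Qed.

Lemma projection_contraction x : N (P x) <= N x.
Proof.
have PP := P_orth.1.
have [->|Px0] := eqVneq (N (P x)) 0; first exact: ipnorm_ge0.
have Px_gt0 : 0 < N (P x) by rewrite lt_def Px0 ipnorm_ge0.
rewrite -(ler_pM2r Px_gt0).
have -> : N (P x) * N (P x) = modulus (ip x (P x)).
  have -> : ip x (P x) = ip (P x) (P x) by rewrite projection_self_adjoint PP.
  rewrite ip_ipnorm modulusC.
  by rewrite ger0_norm ?sqr_ge0// expr2.
exact: cauchy_schwarz.
Qed.

Lemma projection_id x : range P x -> P x = x.
Proof. by case=> y _ <-; rewrite P_orth.1. Qed.

Lemma range_projection_linear a x y : range P x -> range P y ->
  range P (a *: x + y).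
Proof.
by move=> [x' _ <-] [y' _ <-]; exists (a *: x' + y') => //; rewrite linearP.
Qed.

(** Makes the adjoint of [B_n] explicit as a compression of [Bs], so that its limit can be taken
    like that of [B_n]. *)
Lemma adjoint_compression (B Bs : {linear V -> V}) y :
  (forall u v, ip (B u) v = ip u (Bs v)) -> range P y ->
  adjoint ip (restrict_op (P \o B) (range P)) y = P (Bs y).
Proof.
move=> adj Uy; apply: adjoint_eq => /=.
- move=> u v Uu Uv; rewrite -scaleN1r addrC; exact: range_projection_linear.
- by exists (Bs y).
move=> x Ux; rewrite projection_self_adjoint (projection_id Uy) adj.
by rewrite -projection_self_adjoint projection_id.
Qed.

(** Values are prescribed on the domain only, which is all that is known of the adjoint of a
    compression. *)
Lemma compression_linear (f : {linear V -> V}) (T : operator V) :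
  dom T = range P -> (forall x, range P x -> T x = P (f x)) -> linear_operator T.
Proof.
move=> domT TE; rewrite /linear_operator domT; split.
  by exists 0 => //; rewrite linear0.
move=> a x y Ux Uy; have Uxy := range_projection_linear a Ux Uy.
by split=> //; rewrite !TE// (linearP f) (linearP P).
Qed.

End OrthogonalProjection.

(** * Limits of numerical ranges of inverses, and their uniformity *)

Section NumericalRangeLimit.
Context {R : realType} {V : lmodType R[i]}.
Variable ip : {dot V for conjC}.
Local Notation N := (ipnorm ip).

(** The unit vector that realises the value is [T z / N (T z)]. *)
Lemma numerical_range_inverse (T : operator V) z : linear_operator T ->
  (forall y z, dom T y -> dom T z -> T y = T z -> y = z) -> dom T z -> T z != 0 ->
  numerical_range ip (inverse_op T) (ip z (T z) / ip (T z) (T z)).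
Proof.
move=> TL inj Tz Tz0; set r := N (T z).
have r0 : 0 < r by rewrite lt_def ipnorm_eq0 Tz0 ipnorm_ge0.
have [Tz' Tz'E] := linear_operatorZ (r^-1)%:C%C TL Tz.
exists ((r^-1)%:C%C *: T z).
  split=> /=; first by exists ((r^-1)%:C%C *: z).
  by rewrite ipnormZ modulusC ger0_norm ?invr_ge0 ?(ltW r0)// mulVf ?gt_eqF.
rewrite -Tz'E inverse_opK// Tz'E ipZl ipZr ip_ipnorm -/r mulrA mul_conj_modulus.
by rewrite modulusC ger0_norm ?invr_ge0 ?(ltW r0)// mulrC exprVn fmorphV.
Qed.

Lemma numerical_range_limit (Tn : nat -> operator V) (zn : nat -> V) z w (e : R) :
  (forall n, linear_operator (Tn n)) ->
  (forall n y z, dom (Tn n) y -> dom (Tn n) z -> Tn n y = Tn n z -> y = z) ->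
  (forall n, dom (Tn n) (zn n)) ->
  ncvg ip zn z -> ncvg ip (fun n => Tn n (zn n)) w -> N w = 1 -> 0 < e ->
  exists n0, forall n, (n0 <= n)%N -> exists2 nu,
    numerical_range ip (inverse_op (Tn n)) nu & modulus (nu - ip z w) < e.
Proof.
move=> TL inj Tz zcv Tcv w1 e0; set a := ip z w.
pose c := 1 + modulus a.
have c0 : 0 < c by rewrite ltr_pwDl ?modulus_ge0.
(* The entry [1 / 2] keeps [b = |wn| ^ 2] above [1 / 2], so [wn] is nonzero. The error is below
   [d * c / b <= e / 2 / b <= e]. *)
pose d := Num.min 2^-1 (e / 2 / c).
have d0 : 0 < d by rewrite lt_min invr_gt0 ltr0n !divr_gt0.
have [n1 h1] := ncvg_ip zcv Tcv d0; have [n2 h2] := ncvg_ip Tcv Tcv d0.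
exists (maxn n1 n2) => n; rewrite geq_max => /andP[/h1 {}h1 /h2 {}h2].
set wn := Tn n (zn n) in h1 h2.
rewrite !ip_ipnorm w1 expr1n -rmorphB /= modulusC in h2.
set b := N wn ^+ 2 in h2.
have b_half : 2^-1 < b.
  have : `|b - 1| < 2^-1 by rewrite (lt_le_trans h2)// ge_min lexx.
  by rewrite ltr_norml => /andP[? _]; lra.
have b0 : 0 < b by rewrite (lt_trans _ b_half)// invr_gt0 ltr0n.
exists (ip (zn n) wn / ip wn wn).
  apply: numerical_range_inverse (TL n) (@inj n) (Tz n) _.
  by rewrite -(ipnorm_eq0 ip) -sqrf_eq0 -/wn -/b gt_eqF.
have bC : b%:C%C != 0 :> R[i] by rewrite (inj_eq (@complexI R) b 0) gt_eqF.
rewrite ip_ipnorm -/b.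
have -> : ip (zn n) wn / b%:C%C - a =
    (b^-1)%:C%C * ((ip (zn n) wn - a) - (b - 1)%:C%C * a).
  by rewrite fmorphV rmorphB /=; field.
rewrite modulusM modulusC ger0_norm ?invr_ge0 ?(ltW b0)//.
rewrite mulrC ltr_pdivrMr// (le_lt_trans (modulusD _ _))// modulusN modulusM modulusC.
have h3 : `|b - 1| * modulus a <= d * modulus a.
  by rewrite ler_wpM2r ?modulus_ge0// ltW.
have h4 : d * c <= e / 2 by rewrite -ler_pdivlMr// ge_min lexx orbT.
have h5 : e / 2 <= e * b by rewrite ler_wpM2l ?ltW.
by move: h4; rewrite /c mulrDr mulr1; lra.
Qed.

End NumericalRangeLimit.

(* A bounded subset of the plane meets finitely many cells of a grid of mesh
   [h / 4]; approximating one point of each cell suffices. *)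
Lemma uniform_approximation (R : realType) (W : set R[i]) (Wn : nat -> set R[i])
    (M h : R) :
  (forall w, W w -> modulus w <= M) ->
  (forall w e, W w -> 0 < e -> exists n0, forall n, (n0 <= n)%N ->
    exists2 nu, Wn n nu & modulus (nu - w) < e) ->
  0 < h -> exists n0, forall n, (n0 <= n)%N -> forall w, W w ->
    exists2 nu, Wn n nu & modulus (nu - w) < h.
Proof.
move=> WM approx h0.
pose cell (x : R) := Num.truncn ((x + M) * (4 / h)).
(* The successor makes room for the cell of [x = M]. *)
pose K := (Num.truncn ((M + M) * (4 / h))).+1.
have h4 : 0 < 4 / h by rewrite divr_gt0.
have cell_lt x : `|x| <= M -> (cell x < K)%N.
  rewrite ler_norml => /andP[_ xM]; rewrite ltnS; apply: le_truncn.
  by rewrite ler_wpM2r ?(ltW h4)// lerD2r.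
have cell_close x y : `|x| <= M -> `|y| <= M -> cell x = cell y ->
    `|x - y| < h / 4.
  move=> xM yM xy.
  have ge0 t : `|t| <= M -> 0 <= (t + M) * (4 / h).
    by rewrite ler_norml => /andP[? _]; rewrite mulr_ge0 ?(ltW h4)//; lra.
  have /andP[x1 x2] := truncn_itv (ge0 _ xM).
  have /andP[y1 y2] := truncn_itv (ge0 _ yM).
  rewrite -/(cell x) in x1 x2; rewrite -/(cell y) -xy in y1 y2.
  have -> : x - y = ((x + M) * (4 / h) - (y + M) * (4 / h)) * (h / 4).
    by field; rewrite gt_eqF.
  have hh : 0 < h / 4 by rewrite divr_gt0.
  rewrite normrM [X in _ * X]gtr0_norm// gtr_pMl// ltr_norml.
  by rewrite -natr1 in x2 y2; apply/andP; split; lra.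
have /choice[n0 hn0] (p : 'I_K * 'I_K) : exists n0, forall n, (n0 <= n)%N ->
    forall w, W w -> cell (complex.Re w) = p.1 -> cell (complex.Im w) = p.2 ->
    exists2 nu, Wn n nu & modulus (nu - w) < h.
  have [[w [Ww w1 w2]]|none] := pselect (exists w, [/\ W w,
      cell (complex.Re w) = p.1 & cell (complex.Im w) = p.2]); last first.
    by exists 0 => n _ w Ww w1 w2; case: none; exists w.
  (* Half of [h] goes to the chosen point of the cell, a quarter to each coordinate of the
     displacement inside the cell. *)
  have h2 : 0 < h / 2 by rewrite divr_gt0.
  have [n0 hn0] := approx _ _ Ww h2; exists n0 => n /hn0[nu Wnu hnu] v Wv v1 v2.
  exists nu => //.
  have -> : nu - v = (nu - w) + (w - v) by rewrite addrA subrK.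
  rewrite (le_lt_trans (modulusD _ _))//.
  have bd t : W t -> `|complex.Re t| <= M /\ `|complex.Im t| <= M.
    move=> /WM tM; split; first exact: le_trans (normr_Re_le _) tM.
    exact: le_trans (normr_Im_le _) tM.
  have [wR wI] := bd _ Ww; have [vR vI] := bd _ Wv.
  have := modulus_le_ReIm (w - v); rewrite complexReD complexReN.
  have -> : complex.Im (w - v) = complex.Im w - complex.Im v.
    by case: (w) (v) => [? ?] [? ?].
  have := cell_close _ _ wR vR; rewrite w1 v1 => /(_ erefl).
  have := cell_close _ _ wI vI; rewrite w2 v2 => /(_ erefl).
  lra.
exists (\max_p n0 p) => n hn w Ww.
have wR := cell_lt _ (le_trans (normr_Re_le _) (WM _ Ww)).
have wI := cell_lt _ (le_trans (normr_Im_le _) (WM _ Ww)).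
apply: (hn0 (Ordinal wR, Ordinal wI)) => //.
by rewrite (leq_trans _ hn)// leq_bigmax.
Qed.

(** * Galerkin sections of the block operator and the enclosure *)

Theorem theorem6p3 (R : realType) (H : completeNormedModType R[i])
  (ip : {dot H for conjC}) (ip_norm : forall x : H, `|x| ^+ 2 = ip x x)
  (A : operator H) (B D : {linear H -> H}) (gA gD : R)
  (A_linear : linear_operator A) (A_closed : closed_operator A)
  (A_dense : dense (dom A)) (A_res0 : resolvent_set ip A 0)
  (B_bounded : bounded_operator ip (full_op B))
  (D_bounded : bounded_operator ip (full_op D))
  (D_res0 : resolvent_set ip (full_op D) 0)
  (gA_gt0 : 0 < gA) (gD_gt0 : 0 < gD)
  (A_accretive : forall x, dom A x ->
    complex.Re (ip (A x) x) >= gA * ipnorm ip x ^+ 2)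
  (D_dissipative : forall x,
    complex.Re (ip (D x) x) <= - gD * ipnorm ip x ^+ 2)
  (P : nat -> {linear H -> H}) (An : nat -> operator H)
  (approx : approximates_strongly ip A P An)
  (P_orthogonal : forall n, orthogonal_projection ip (P n))
  (An_accretive : forall n x, range (P n) x ->
    complex.Re (ip (An n x) x) >= gA * ipnorm ip x ^+ 2)
  (m : nat) (s : 'I_m -> R[i])
  (s_strip : forall j, - gD < complex.Re (s j) < gA)
  (eps : R) (eps_gt0 : 0 < eps)
  (eps_lt : forall j, eps < strip_gap gA gD (s j))
  (delta : 'I_m -> R)
  (delta_gt : forall j,
    delta j > eps / (strip_gap gA gD (s j) ^+ 2 - eps * strip_gap gA gD (s j))) :
  let cA := block_op A (full_op B) (adjoint ip (full_op B)) (full_op D) in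
  let Bn n := restrict_op (P n \o B) (range (P n)) in
  let Dn n := restrict_op (P n \o D) (range (P n)) in
  let cAn n := block_op (An n) (Bn n) (adjoint ip (Bn n)) (Dn n) in
  exists n0 : nat, forall n, (n0 <= n)%N ->
    pseudospectrum (prod_dot ip) eps cA `<=`
    \bigcap_(j in [set: 'I_m])
      translate
        (inv_set (nbhd (delta j)
          (numerical_range (prod_dot ip) (inverse_op (shift_op (cAn n) (s j))))))
        (s j).
Proof.
move=> cA Bn Dn cAn.
set N := ipnorm ip; pose N2 := ipnorm (prod_dot ip).
have cpl := ip_complete_hilbert ip_norm.
have [Bs Bs_bounded adj] := bounded_adjoint cpl B_bounded.
have [Ai [Ai_bounded AiE Ai_dom A_AiK Ai_AK]] := inverse_op_linear A_linear A_res0.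
have adjB : adjoint ip (full_op B) = full_op Bs.
  by congr Operator; apply/funext => y; apply: adjoint_eq => // x _; apply: adj.
have Re_adj x y : complex.Re (ip (B y) x) = complex.Re (ip (Bs x) y).
  by rewrite adj ip_conj complexRe_conj.
have -> : cA = block_op A (full_op B) (full_op Bs) (full_op D).
  by rewrite /cA adjB.
case: approx => _ _ PP P_cvg dom_An An_linear _ An_bij An_inv_cvg.
have adjBn n y : range (P n) y -> adjoint ip (Bn n) y = P n (Bs y).
  exact: adjoint_compression.
have cAn_linear n : linear_operator (cAn n).
  apply: block_op_linear => //.
  - exact: (compression_linear (f := B)).
  - by apply: (compression_linear (f := Bs)) => // x; apply: adjBn.
  - exact: (compression_linear (f := D)).
have dom_cAn n z : range (P n) z.1 -> range (P n) z.2 -> dom (cAn n) z.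
  by move=> U1 U2; split; split; rewrite /= ?dom_An.
(* Compression preserves the hypotheses of [saddle_lower_bound] with the same constants; this makes
   the shifted sections injective, hence their [inverse_op] meaningful. *)
have cAn_lower j n z : dom (cAn n) z ->
    strip_gap gA gD (s j) * N2 z <= N2 (shift_op (cAn n) (s j) z).
  case: z => x y [[_ Ux] [Uy _]]; rewrite /= in Ux Uy.
  have Re_P u v : range (P n) v -> ip (P n u) v = ip u v.
    move=> Uv; rewrite (projection_self_adjoint (P_orthogonal n)).
    by rewrite (projection_id (P_orthogonal n)).
  apply: saddle_lower_bound => //=.
  - exact: An_accretive.
  - by rewrite Re_P.
  - by have := adjBn n x Ux; rewrite /= => ->; rewrite !Re_P.
(* [An n] sends the first component exactly to [P n (A z.1)], so no limit of [An n] is required. *)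
pose zn (z : H * H) n := (inverse_op (An n) (P n (A z.1)), P n z.2).
have An_inv n x : range (P n) (inverse_op (An n) (P n x)) /\
    An n (inverse_op (An n) (P n x)) = P n x.
  have [_ inj surj] := An_bij n; have [|y Uy <-] := surj (P n x); first by exists x.
  rewrite inverse_opK ?dom_An// => u v Uu Uv; apply: inj; rewrite inE //.
have dom_zn z n : dom (cAn n) (zn z n).
  by apply: dom_cAn; [case: (An_inv n (A z.1)) | exists z.2].
have P_ncvg x : ncvg ip (fun n => P n x) x := cvg_ncvg ip_norm (P_cvg x).
have P_le n x : N (P n x) <= N x by apply: projection_contraction.
have zn_ncvg z : dom A z.1 -> ncvg (prod_dot ip) (zn z) z.
  move=> Az; apply: ncvg_pair => //=.
  by have := cvg_ncvg ip_norm (An_inv_cvg (A z.1)); rewrite -AiE Ai_AK.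
have Tzn_ncvg j z : dom A z.1 -> ncvg (prod_dot ip)
    (fun n => shift_op (cAn n) (s j) (zn z n))
    (shift_op (block_op A (full_op B) (full_op Bs) (full_op D)) (s j) z).
  move=> Az; have z1 : ncvg ip (fun n => (zn z n).1) z.1.
    by have := cvg_ncvg ip_norm (An_inv_cvg (A z.1)); rewrite -AiE Ai_AK.
  have z2 : ncvg ip (fun n => (zn z n).2) z.2 := P_ncvg z.2.
  have PM (f : {linear H -> H}) (u : nat -> H) l :
      bounded_operator ip (full_op f) -> ncvg ip u l ->
      ncvg ip (fun n => P n (f (u n))) (f l).
    by move=> bf ul; apply: ncvg_contraction => //; apply: ncvg_bounded.
  apply: ncvg_pair => /=.
  - have -> : (fun n => An n (inverse_op (An n) (P n (A z.1))) +
        P n (B (P n z.2)) - s j *: inverse_op (An n) (P n (A z.1))) =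
      (fun n => P n (A z.1) + P n (B (P n z.2)) - s j *: (zn z n).1).
      by apply/funext => n; case: (An_inv n (A z.1)) => _ ->.
    by apply: ncvgB; [apply: ncvgD => //; apply: PM | apply: ncvgZ].
  - have -> : (fun n => adjoint ip (Bn n) (inverse_op (An n) (P n (A z.1))) +
        P n (D (P n z.2)) - s j *: P n z.2) =
      (fun n => P n (Bs (zn z n).1) + P n (D (P n z.2)) - s j *: P n z.2).
      by apply/funext => n; rewrite adjBn//; case: (An_inv n (A z.1)).
    by apply: ncvgB; [apply: ncvgD; apply: PM | apply: ncvgZ].
suff each j : exists n0, forall n, (n0 <= n)%N ->
    pseudospectrum (prod_dot ip) eps
      (block_op A (full_op B) (full_op Bs) (full_op D)) `<=`
    translate (inv_set (nbhd (delta j)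
      (numerical_range (prod_dot ip) (inverse_op (shift_op (cAn n) (s j)))))) (s j).
  have [n0 hn0] := choice each.
  exists (\max_j n0 j) => n hn lambda hlam j _.
  by apply: (hn0 j n) => //; rewrite (leq_trans _ hn)// leq_bigmax.
set g := strip_gap gA gD (s j).
set T := shift_op (block_op A (full_op B) (full_op Bs) (full_op D)) (s j).
have g0 : 0 < g := lt_trans eps_gt0 (eps_lt j).
(* [lambda] does not occur in this set, so one index serves the whole pseudospectrum. *)
pose W := [set prod_dot ip z (T z) | z in dom T `&` [set z | N2 (T z) = 1]].
pose Wn n := numerical_range (prod_dot ip) (inverse_op (shift_op (cAn n) (s j))).
(* The bound [g^-1] holds because [|<z, T z>| <= |z| <= |T z| / g]; the tolerance is the margin left
   by [delta_gt]. *)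
have [|||n0 hn0] := @uniform_approximation _ W Wn g^-1
    (delta j - eps / (g ^+ 2 - eps * g)).
- move=> _ [z [Tz Tz1] <-].
  apply: le_trans (cauchy_schwarz (prod_dot ip) _ _) _; rewrite -/N2 Tz1 mulr1.
  rewrite -[leRHS]mul1r ler_pdivlMr// mulrC -Tz1.
  exact: (@block_op_lower_bound _ _ ip A B Bs D).
- move=> _ e [z [[[Az _] _] Tz1] <-] e0.
  apply: (@numerical_range_limit _ _ (prod_dot ip) _ (zn z)) => //.
  + by move=> n; apply: linear_operator_shift.
  + move=> n; apply: (@linear_operator_inj _ _ (prod_dot ip) _ g) => //.
      exact: linear_operator_shift.
    by move=> x; apply: cAn_lower.
  + by move=> n; apply: dom_zn.
  + exact: zn_ncvg.
  + exact: Tzn_ncvg.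
- by rewrite subr_gt0 delta_gt.
exists n0 => n hn lambda hlam.
have [|lams [z [Az Tz1 hz]]] := @pseudospectrum_near_range _ _ ip A Ai B Bs D
  gA gD (s j) cpl A_linear Ai_dom A_AiK Ai_bounded B_bounded Bs_bounded D_bounded
  adj A_accretive D_dissipative gA_gt0 (s_strip j) eps lambda eps_gt0 (eps_lt j) _.
  exact: hlam.
have [|nu Wnu hnu] := hn0 n hn (prod_dot ip z (T z)); first by exists z.
exists (lambda - s j); last by rewrite subrK.
exists (lambda - s j)^-1; last by rewrite invrK.
split; last by apply/eqP; rewrite invr_eq0 subr_eq0.
have : (dist_set ((lambda - s j)^-1)%R (Wn n) <=
    (modulus ((lambda - s j)^-1 - nu)%R)%:E)%E.
  by apply: ereal_inf_lbound; exists nu.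
move=> /le_lt_trans; apply; rewrite lte_fin.
(* Triangle inequality through [<z, T z>]: the margin and [eps / (g ^ 2 - eps g)] add up to
   [delta j]. *)
rewrite modulusB -(subrK (prod_dot ip z (T z)) nu) -addrA.
by rewrite (le_lt_trans (modulusD _ _))// -ltrBrDr (lt_le_trans hnu)// lerD2l lerN2 ltW.
Qed.
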